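(* Let $\mathcal{S}$ be a finite set of sensitive attributes with $|\mathcal{S}|\ge 3$, let $L:=|\mathcal{S}|-1$, let $t\ge 2$ be an integer that divides $L$, and let $\ell\in\{1,\dots,|\mathcal{S}|\}$. Let $\ell_{[t]}$ be the worst-case post-linkage diversity of $t$ anonymized datasets each obeying $\ell$-diversity (defined in the context). Then $\ell_{[t]}=1$ if $\ell\le L\cdot\frac{t-1}{t}+1$, and if $\ell> L\cdot\frac{t-1}{t}+1$, then $$\ell_{[t]}=L+1-(L-\ell+1)\,t.$$
   Context: $\mathcal{Q}$ is a finite nonempty set of quasi-identifiers and $\mathcal{S}$ a finite set of sensitive attributes. A dataset of size $N$ is a list of $N$ records $(\mathbf{q}_i,s_i)\in\mathcal{Q}\times\mathcal{S}$, one per user $i\in\{1,\dots,N\}$. An anonymized dataset $\overline{\mathcal{D}}$ is a dataset together with a partition $\overline{\mathcal{Q}}$ of $\mathcal{Q}$ into nonempty equivalence classes; for $\overline{\mathbf{q}}\in\overline{\mathcal{Q}}$ and $s\in\mathcal{S}$, $n^{(\overline{\mathbf{q}})}(s)$ is the number of records $(\mathbf{q}_i,s_i)$ with $\mathbf{q}_i\in\overline{\mathbf{q}}$ and $s_i=s$. It obeys $\ell$-diversity if $\ell\in\{1,\dots,|\mathcal{S}|\}$ is the largest integer such that every class $\overline{\mathbf{q}}\in\overline{\mathcal{Q}}$ with $\sum_{s}n^{(\overline{\mathbf{q}})}(s)>0$ satisfies $|\{s\in\mathcal{S}: n^{(\overline{\mathbf{q}})}(s)>0\}|\ge\ell$.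 Linkage: let $\overline{\mathcal{D}}_1,\dots,\overline{\mathcal{D}}_t$ be anonymized datasets of equal size $N$ (each with its own partition of $\mathcal{Q}$), and let $\mathbf{q}\in\mathcal{Q}$ be the quasi-identifier of a user who contributes one and the same record $(\mathbf{q},s^* )$ to all $t$ datasets. Let $\overline{\mathbf{q}}_j$ be the equivalence class of $\overline{\mathcal{D}}_j$ containing $\mathbf{q}$, and put $n^{(\mathbf{q})}_{[t]}(s):=\min_{1\le j\le t}n^{(\overline{\mathbf{q}}_j)}(s)$, with counts $n^{(\overline{\mathbf{q}}_j)}(s)$ taken in $\overline{\mathcal{D}}_j$. The post-linkage dataset $\overline{\mathcal{D}}^{(\mathbf{q})}_{[t]}$ consists of $n^{(\mathbf{q})}_{[t]}(s)$ records with sensitive attribute $s$, for each $s\in\mathcal{S}$, all in the single equivalence class $\bigcap_{j}\overline{\mathbf{q}}_j$. Thus it obeys $\widehat{\ell}$-diversity with $\widehat{\ell}=|\{s: n^{(\mathbf{q})}_{[t]}(s)>0\}|$. $\ell_{[t]}$ is the minimum of this $\widehat{\ell}$ over all $t$-tuples $(\overline{\mathcal{D}}_1,\dots,\overline{\mathcal{D}}_t)$ of anonymized datasets of equal size (the common size $N$ being arbitrary), each obeying $\ell$-diversity, that have such a common user with quasi-identifier $\mathbf{q}$. *)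

(* Defs.v *)
From mathcomp Require Import all_boot all_order all_algebra.

Set Implicit Arguments.
Unset Strict Implicit.
Unset Printing Implicit Defensive.

Record anon_dataset (Q S : finType) (N : nat) : Type := AnonDataset {
  records : N.-tuple (Q * S);
  classes : {set {set Q}};
  classesP : partition classes [set: Q]
}.

Definition class_count (Q S : finType) (N : nat) (D : anon_dataset Q S N)
    (c : {set Q}) (s : S) : nat :=
  #|[set i : 'I_N | ((tnth (records D) i).1 \in c)
                    && ((tnth (records D) i).2 == s)]|.

Definition diverse_at_least (Q S : finType) (N : nat) (D : anon_dataset Q S N)
    (l : nat) : Prop :=
  forall c : {set Q}, c \in classes D ->
    0 < \sum_(s : S) class_count D c s ->
    l <= #|[set s : S | 0 < class_count D c s]|.

Definition obeys_diversity (Q S : finType) (N : nat) (D : anon_dataset Q S N)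
    (l : nat) : Prop :=
  [/\ 1 <= l <= #|S|, diverse_at_least D l
    & forall k : nat, diverse_at_least D k -> k <= l].

Definition class_of (Q S : finType) (N : nat) (D : anon_dataset Q S N)
    (q : Q) : {set Q} :=
  pblock (classes D) q.

(* The common user's record may sit at a different position in each dataset. *)
Definition common_user (Q S : finType) (N t : nat)
    (D : 'I_t -> anon_dataset Q S N) (q : Q) : Prop :=
  exists s : S, forall j : 'I_t,
    exists i : 'I_N, tnth (records (D j)) i = (q, s).

(* Every count is at most N, so for t > 0 the default value N of the iterated
   minimum does not affect the result. *)
Definition linked_count (Q S : finType) (N t : nat)
    (D : 'I_t -> anon_dataset Q S N) (q : Q) (s : S) : nat :=
  \big[minn/N]_(j < t) class_count (D j) (class_of (D j) q) s.

(* All post-linkage records lie in one equivalence class, so the diversity of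
   the post-linkage dataset is its number of distinct sensitive attributes. *)
Definition linked_diversity (Q S : finType) (N t : nat)
    (D : 'I_t -> anon_dataset Q S N) (q : Q) : nat :=
  #|[set s : S | 0 < linked_count D q s]|.

Definition worst_case_diversity (Q S : finType) (q : Q) (t l m : nat) : Prop :=
  (exists (N : nat) (D : 'I_t -> anon_dataset Q S N),
     [/\ forall j, obeys_diversity (D j) l, common_user D q
       & linked_diversity D q = m])
  /\ (forall (N : nat) (D : 'I_t -> anon_dataset Q S N),
        (forall j, obeys_diversity (D j) l) -> common_user D q ->
        m <= linked_diversity D q).

(* Main.v *)
Require Import Defs.
From mathcomp Require Import all_boot all_order all_algebra.
From mathcomp Require Import zify.
Import GRing.Theory Num.Theory.
Local Open Scope ring_scope.

Set Implicit Arguments.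
Unset Strict Implicit.

(** Only the set of sensitive attributes occurring in the class of the common
    user matters in each dataset. With k := |S| - l, the attributes lost by
    linkage are the union of t sets of size at most k, none of which contains
    the attribute s* of the common user; hence at least
    max(1, |S| - t k) attributes survive. Conversely, enumerate S with s* last
    and let the lost sets be intervals of length k that tile the first
    min(t k, L) positions, the last ones being shifted left so as to avoid s*. *)

(** The default [N] is one more argument of the minimum, whence the conjunct [0 < N]. *)
Lemma bigminn_gt0 (I : finType) (N : nat) (F : I -> nat) :
  (0 < \big[minn/N]_i F i)%N = (0 < N)%N && [forall i, 0 < F i]%N.
Proof.
transitivity ((0 < N) && all (fun i => 0 < F i) (index_enum I))%N.
  elim: (index_enum I) => [|i r IHr]; first by rewrite big_nil andbT.
  by rewrite big_cons leq_min IHr andbCA.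
congr andb; apply/allP/forallP => [F_gt0 i|F_gt0 i _]; last exact: F_gt0.
by rewrite F_gt0 ?mem_index_enum.
Qed.

Lemma card_ord_interval (n a b : nat) : (b <= n)%N ->
  #|[set i : 'I_n | a <= i < b]|%N = (b - a)%N.
Proof.
move=> le_bn; rewrite -sum1_card (eq_bigl (fun i : 'I_n => a <= i < b)%N).
  rewrite -(big_ord_widen_cond _ _ (fun=> 1%N) le_bn) -(big_geq_mkord _ _ xpredT (fun=> 1%N)).
  by rewrite sum_nat_const_nat muln1.
by move=> i; rewrite inE.
Qed.

Lemma card_rank_interval (T : finType) (a b : nat) : (b <= #|T|)%N ->
  #|[set x : T | a <= enum_rank x < b]|%N = (b - a)%N.
Proof.
move=> le_bT; rewrite -(card_ord_interval a le_bT).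
rewrite -(card_imset _ enum_rank_inj).
apply/eq_card => i; rewrite inE; apply/imsetP/idP => [[x]|ai].
  by rewrite inE => ? ->.
by exists (enum_val i); rewrite ?inE enum_valK.
Qed.

Section Dataset.
Variables (Q S : finType) (N : nat) (D : anon_dataset Q S N).

(** Diversity sees the counts only through their positivity, so these sets replace counts below. *)
Definition support (c : {set Q}) : {set S} := [set s | 0 < class_count D c s]%N.

Lemma supportP (c : {set Q}) (s : S) :
  reflect (exists2 i, (tnth (records D) i).1 \in c & (tnth (records D) i).2 = s)
          (s \in support c).
Proof.
rewrite inE; apply: (iffP card_gt0P) => [[i]|[i ic <-]].
  by rewrite inE => /andP[ic /eqP<-]; exists i.
by exists i; rewrite inE ic eqxx.
Qed.

Lemma sum_class_count_gt0 (c : {set Q}) (s : S) : s \in support c ->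
  (0 < \sum_(s' : S) class_count D c s')%N.
Proof. by rewrite inE (bigD1 s) //= addn_gt0 => ->. Qed.

Lemma class_of_classes (q : Q) : class_of D q \in classes D.
Proof.
by rewrite pblock_mem // (cover_partition (classesP D)) inE.
Qed.

Lemma mem_class_of (q : Q) : q \in class_of D q.
Proof. by rewrite mem_pblock (cover_partition (classesP D)) inE. Qed.

Lemma record_support (q : Q) (s : S) (i : 'I_N) :
  tnth (records D) i = (q, s) -> s \in support (class_of D q).
Proof.
by move=> Di; apply/supportP; exists i; rewrite Di ?mem_class_of.
Qed.

End Dataset.

(** A minimum is positive iff all its arguments are, so linkage intersects supports. *)
Lemma linked_diversityE (Q S : finType) (N t : nat)
    (D : 'I_t -> anon_dataset Q S N) (q : Q) : (0 < N)%N ->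
  linked_diversity D q = #|\bigcap_j support (D j) (class_of (D j) q)|.
Proof.
move=> N_gt0; apply: eq_card => s; rewrite inE bigminn_gt0 N_gt0 /=.
apply/forallP/bigcapP => [sD j _|sD j]; first by rewrite inE.
by have := sD j isT; rewrite inE.
Qed.

(** Union bound on the complements. *)
Lemma leq_card_bigcap (T : finType) (t k : nat) (A : 'I_t -> {set T}) :
  (forall j, #|~: A j| <= k)%N -> (#|T| - t * k <= #|\bigcap_j A j|)%N.
Proof.
move=> Ak; rewrite -(cardsC (\bigcap_j A j)) leq_subLR addnC leq_add2r.
rewrite setC_bigcap; apply: (@leq_trans (\sum_(j < t) #|~: A j|)).
  elim/big_rec2: _ => [|j m B _ leBm]; first by rewrite cards0.
  by rewrite (leq_trans (leq_card_setU _ _)) ?leq_add2l.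
by rewrite (leq_trans (leq_sum _ (fun j _ => Ak j))) // sum_nat_const card_ord.
Qed.

Lemma linked_diversity_ge (Q S : finType) (N t l : nat)
    (D : 'I_t -> anon_dataset Q S N) (q : Q) : (0 < t)%N ->
    (forall j, diverse_at_least (D j) l) -> common_user D q ->
  (maxn 1 (#|S| - t * (#|S| - l)) <= linked_diversity D q)%N.
Proof.
move=> t_gt0 Dl [s Ds].
have sD j : s \in support (D j) (class_of (D j) q).
  by have [i] := Ds j; apply: record_support.
(* The common record has an index in ['I_N]. *)
have N_gt0 : (0 < N)%N by have [i _] := Ds (Ordinal t_gt0); apply: leq_ltn_trans (ltn_ord i).
rewrite linked_diversityE // geq_max; apply/andP; split.
  by apply/card_gt0P; exists s; apply/bigcapP.
apply: leq_card_bigcap => j; have := cardsC (support (D j) (class_of (D j) q)).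
have := Dl j _ (class_of_classes _ q) (sum_class_count_gt0 (sD j)).
rewrite -/(support _ _); lia.
Qed.

Section OneClass.
Variables (Q S : finType) (q : Q) (s0 : S) (l : nat).

Lemma partition_setT : partition [set [set: Q]] [set: Q].
Proof.
rewrite /partition /cover big_set1 eqxx trivIset1 !inE eq_sym.
by apply/set0Pn; exists q.
Qed.

(** One record per attribute of [A]; when [#|A| = l] the [nth] default [s0] is never reached. The
    size [l] is the same for all such [A], as linkage requires. *)
Definition one_class_dataset (A : {set S}) : anon_dataset Q S l :=
  AnonDataset [tuple (q, nth s0 (enum A) i) | i < l] partition_setT.

Variables (A : {set S}) (cardA : #|A| = l).

Lemma one_class_record (s : S) : s \in A ->
  exists i, tnth (records (one_class_dataset A)) i = (q, s).
Proof.
move=> sA; have lt_l : (index s (enum A) < l)%N.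
  by rewrite -cardA cardE index_mem mem_enum.
by exists (Ordinal lt_l); rewrite tnth_mktuple nth_index ?mem_enum.
Qed.

Lemma support_one_class : support (one_class_dataset A) [set: Q] = A.
Proof.
apply/setP => s; apply/supportP/idP => [[i _ <-]|/one_class_record[i Di]].
  by rewrite tnth_mktuple -mem_enum mem_nth // -cardE cardA.
by exists i; rewrite ?inE ?Di.
Qed.

Lemma class_of_one_class : class_of (one_class_dataset A) q = [set: Q].
Proof.
by have := class_of_classes (one_class_dataset A) q; rewrite inE => /eqP.
Qed.

Lemma one_class_diversity :
  (0 < l)%N -> obeys_diversity (one_class_dataset A) l.
Proof.
move=> l_gt0; split; first by rewrite l_gt0 -cardA max_card.
  move=> c; rewrite inE => /eqP-> _.
  by rewrite -/(support _ _) support_one_class cardA.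
move=> k /(_ [set: Q]); rewrite inE eqxx -/(support _ _) support_one_class.
have [s sA] : exists s, s \in A by apply/card_gt0P; rewrite cardA.
rewrite cardA; apply=> //; apply: (@sum_class_count_gt0 _ _ _ _ _ s).
by rewrite support_one_class.
Qed.

End OneClass.

(** The intervals starting at [j * k] tile [[0, t * k)]; capping the start at [L - k] pulls those
    that overshoot back below [L]. *)
Lemma shifted_intervals_cover (L k t x : nat) : (k <= L)%N ->
  [exists j : 'I_t, minn (j * k) (L - k) <= x < minn (j * k) (L - k) + k]%N
  = (x < minn (t * k) L)%N.
Proof.
move=> kL; apply/existsP/idP => [[j xj]|xt].
  have : (j.+1 * k <= t * k)%N by rewrite leq_mul2r ltn_ord orbT.
  by rewrite mulSn; lia.
have k_gt0 : (0 < k)%N by case: k xt {kL} => //; rewrite muln0; lia.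
(* The uncapped tile containing [x] has index [x %/ k]; capping only lowers its start, and a capped
   interval ends at [L], still above [x]. *)
have lt_t : (x %/ k < t)%N by rewrite ltn_divLR //; lia.
exists (Ordinal lt_t) => /=.
have := divn_eq x k; have := ltn_pmod x k_gt0; lia.
Qed.

Lemma extremal_datasets (Q S : finType) (q : Q) (t l : nat) :
    (0 < t)%N -> (0 < l <= #|S|)%N ->
  exists D : 'I_t -> anon_dataset Q S l,
    [/\ forall j, obeys_diversity (D j) l, common_user D q
      & linked_diversity D q = maxn 1 (#|S| - t * (#|S| - l))].
Proof.
move=> t_gt0 /andP[l_gt0 leS].
set L := (#|S|.-1)%N; set k := (#|S| - l)%N.
have kL : (k <= L)%N by rewrite /k /L; lia.
have L_lt : (L < #|S|)%N by rewrite /L; lia.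
pose a (j : 'I_t) := minn (j * k) (L - k).
pose A j := ~: [set s : S | a j <= enum_rank s < a j + k]%N.
have cardA j : #|A j| = l.
  by rewrite /A cardsCs setCK card_rank_interval /a /k; lia.
(* The attribute of last rank [L]; every removed interval ends at or before [L], so it always
   survives. *)
pose s0 : S := enum_val (Ordinal L_lt).
have s0A j : s0 \in A j by rewrite !inE enum_valK /= /a; lia.
exists (fun j => one_class_dataset q s0 l (A j)); split.
- by move=> j; apply: one_class_diversity.
- by exists s0 => j; apply: one_class_record.
rewrite linked_diversityE //.
under eq_bigr do rewrite class_of_one_class support_one_class //.
(* Exactly the ranks below [minn (t * k) L] are lost; the cap at [L] becomes the [1] in the
   maximum. *)
transitivity #|[set s : S | minn (t * k) L <= enum_rank s < #|S|]|%N; last first.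
  by rewrite card_rank_interval // /L; lia.
apply: eq_card => s; rewrite inE ltn_ord andbT leqNgt.
rewrite -(shifted_intervals_cover _ _ kL) negb_exists.
apply/bigcapP/forallP => [sA j|sA j _]; last by rewrite !inE sA.
by have := sA j isT; rewrite !inE.
Qed.

(** Multiply by [t] and put [l = L + 1 - k]: the terms [t * L] and [t] cancel, leaving
    [L <= t * k]. *)
Lemma diversity_threshold (L t l : nat) : (0 < t)%N -> (l <= L.+1)%N ->
  (l%:R <= L%:R * ((t%:R - 1) / t%:R) + 1 :> rat) = (L <= t * (L.+1 - l))%N.
Proof.
move=> t_gt0 leL; have t_gt0' : 0 < t%:R :> rat by rewrite ltr0n.
rewrite mulrA -(ler_pM2r t_gt0') [X in _ <= X]mulrDl mul1r divfK ?lt0r_neq0 //.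
rewrite -(natrB _ t_gt0) -!natrM -natrD ler_nat.
have [k def_L] : exists k, L.+1 = (l + k)%N by exists (L.+1 - l)%N; lia.
have -> : (L.+1 - l = k)%N by lia.
have : (t * L.+1 = t * l + t * k)%N by rewrite def_L mulnDr.
(* Makes the truncated difference [t * L - L] exact for [lia]. *)
have : (L <= t * L)%N by rewrite leq_pmull.
rewrite mulnS mulnBr muln1 (mulnC l) (mulnC L); lia.
Qed.

Unset Implicit Arguments.
Set Strict Implicit.

Theorem proposition3p1 (Q S : finType) (q : Q) (L t l : nat)
    (hS : (3 <= #|S|)%N) (hL : L = (#|S| - 1)%N)
    (ht : (2 <= t)%N) (htL : (t %| L)%N) (hl : (1 <= l <= #|S|)%N) :
  exists m : nat,
    worst_case_diversity S q t l m
    /\ (l%:R <= L%:R * ((t%:R - 1) / t%:R) + 1 :> rat -> m = 1%N)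
    /\ (l%:R > L%:R * ((t%:R - 1) / t%:R) + 1 :> rat ->
        m%:Z = L%:Z + 1 - (L%:Z - l%:Z + 1) * t%:Z).
Proof.
have t_gt0 : (0 < t)%N by lia.
exists (maxn 1 (#|S| - t * (#|S| - l))); split; [split | split].
- by exists l; apply: extremal_datasets.
- move=> N D Dl; apply: linked_diversity_ge => // j.
  by case: (Dl j).
(* Here [L <= t * (L.+1 - l)], so the second argument of the maximum is at most 1. *)
- rewrite diversity_threshold //; last by lia.
  have -> : #|S| = L.+1 by lia.
  lia.
(* Here [t * (L.+1 - l) < L], so the natural subtraction is exact and its value exceeds 1. *)
- rewrite Order.TotalTheory.ltNge diversity_threshold //; last by lia.
  have -> : L%:Z - l%:Z + 1 = (L.+1 - l)%N%:Z by lia.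
  have -> : #|S| = L.+1 by lia.
  by rewrite mulrC -PoszM; lia.
Qed.
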